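(* Let $d\ge5$. Then $$\liminf_{n\to\infty}\mathbb{P}_v\big(\Psi(R_n^d)=v\big)>0.$$
   Context: $(X_n)_{n\ge0}$ is the simple random walk on the nearest-neighbour lattice $\mathbb{Z}^d$; $\mathbb{P}_v$ is its law when started at the source $X_0=v\in\mathbb{Z}^d$ (the probability above does not depend on $v$). $G_t^d$ is the $t$-step trace: the subgraph of $\mathbb{Z}^d$ consisting of the vertices $X_0,\dots,X_t$ and the edges $\{X_i,X_{i+1}\}$, $0\le i<t$. Let $\tau_n=\inf\{t\ge0:|V(G_t^d)|=n\}$ and $R_n^d=G_{\tau_n}^d$, the trace at the first time it has exactly $n$ vertices. For a finite connected graph $G$, a diametrical path is a path in $G$ of length $\mathrm{diam}(G)$ joining two vertices at graph distance $\mathrm{diam}(G)$. The estimator $\Psi$ is the randomised function which, on input $G$, selects a uniformly random diametrical path of $G$ and outputs one of its two endpoints uniformly at random. *)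

(* Defs.v *)
From HB Require Import structures.
From mathcomp Require Import all_boot all_order all_algebra.
From mathcomp Require Import finmap.
From mathcomp Require Import all_classical all_reals all_analysis.

Set Implicit Arguments.
Unset Strict Implicit.
Unset Printing Implicit Defensive.

Import Order.TTheory GRing.Theory Num.Theory.

Local Open Scope classical_set_scope.
Local Open Scope fset_scope.
Local Open Scope ring_scope.

Notation lattice d := 'rV[int]_d.

Definition lattice_adj (d : nat) (x y : lattice d) : bool :=
  \sum_(i < d) `|x ord0 i - y ord0 i| == 1.

Definition srw_step (R : realType) (d : nat) (x y : lattice d) : R :=
  if lattice_adj x y then (2 * d)%:R^-1 else 0.

(* The law of a walk is fixed by its finite-dimensional distributions. As the
   lattice is countable with the discrete sigma-algebra, measurability of X i
   amounts to measurability of its level sets. *)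
Definition is_simple_random_walk (R : realType) (disp : measure_display)
    (T : measurableType disp) (P : probability T R) (d : nat) (v : lattice d)
    (X : nat -> T -> lattice d) : Prop :=
  (forall (i : nat) (x : lattice d), measurable [set w | X i w = x]) /\
  (forall (n : nat) (x : nat -> lattice d),
     P [set w | forall i : nat, (i <= n)%N -> X i w = x i] =
     ((x 0%N == v)%:R * \prod_(i < n) srw_step R (x i) (x i.+1))%:E).

(* Edges are stored as two-element sets of vertices. *)
Record fsgraph (K : choiceType) := FSGraph {
  gverts : {fset K};
  gedges : {fset {fset K}} }.

Section FiniteGraph.
Variables (K : choiceType) (G : fsgraph K).

Definition gadj : rel (gverts G) :=
  fun x y => [fset val x; val y] \in gedges G.

(* Least length of a walk from x to y; a shortest walk has length less than
   the number of vertices, and that number is the value for disconnected x, y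
   (this does not arise for connected graphs). *)
Definition gdist (x y : gverts G) : nat :=
  \big[minn/#|{: gverts G}|]_(k < #|{: gverts G}| |
     [exists p : k.-tuple (gverts G), path gadj x p && (last x p == y)]) k.

Definition gdiam : nat := \max_(x : gverts G) \max_(y : gverts G) gdist x y.

Definition path_src (p : gdiam.+1.-tuple (gverts G)) := tnth p ord0.
Definition path_tgt (p : gdiam.+1.-tuple (gverts G)) := tnth p ord_max.

(* Paths are encoded by their vertex sequences. A path of positive length is
   represented exactly twice, once per direction, so a uniform sequence is a
   uniform path; when the diameter is 0 the paths are the single vertices. *)
Definition diametrical_paths : {set gdiam.+1.-tuple (gverts G)} :=
  [set p : gdiam.+1.-tuple (gverts G) | [&& uniq p, sorted gadj p &
     gdist (path_src p) (path_tgt p) == gdiam]]%SET.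

(* Probability that Psi outputs u on input G. *)
Definition Psi_prob (R : realType) (u : K) : R :=
  \sum_(p in diametrical_paths) #|diametrical_paths|%:R^-1 *
    ((val (path_src p) == u)%:R / 2 + (val (path_tgt p) == u)%:R / 2).

End FiniteGraph.

Section Trace.
Variables (K : choiceType) (x : nat -> K).

Definition trace_graph (t : nat) : fsgraph K :=
  FSGraph [fset x i | i in iota 0 t.+1] [fset [fset x i; x i.+1] | i in iota 0 t].

(* First time at which the trace has n vertices; None stands for infinity. *)
Definition range_time (n : nat) : option nat :=
  if pselect (exists t : nat, #|` gverts (trace_graph t)| == n) is left h
  then Some (ex_minn h) else None.

Definition range_graph (n : nat) : option (fsgraph K) :=
  omap trace_graph (range_time n).

End Trace.

(* The probability that Psi (R_n) = u. The internal randomness of Psi is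
   independent of the walk, hence its output law Psi_prob is averaged over the
   law of R_n; the event that R_n is undefined does not contribute. *)
Definition Psi_range_prob (R : realType) (disp : measure_display)
    (T : measurableType disp) (P : probability T R) (d : nat)
    (X : nat -> T -> lattice d) (n : nat) (u : lattice d) : \bar R :=
  (\int[P]_w (if range_graph (fun i => X i w) n is Some G
              then Psi_prob G R u else 0)%:E)%E.

(* Main.v *)
Require Import Defs.
From mathcomp Require Import all_boot all_order all_algebra.
From mathcomp Require Import finmap.
From mathcomp Require Import all_classical all_reals all_analysis.
From mathcomp Require Import zify ring lra.

Set Implicit Arguments.
Unset Strict Implicit.
Unset Printing Implicit Defensive.

Import Order.TTheory GRing.Theory Num.Theory.

(** The starting point [v] is an end of every diametrical path as soon as the
    trajectory passes through sufficiently many bottlenecks, and in dimension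
    at least five it does so with positive probability.

    Call a time [t] a cut of width [m] ([cut_at]) when no vertex visited up to
    time [t] is visited from time [t + m] on. A path of the trace that goes from
    the past of a cut to its future contains a vertex visited during the cut.
    This has two consequences. First, if the walk has [k] disjoint cuts before
    time [r], then [X_r] is at distance at least [k] from [v]
    ([gdist_ge_cuts]). Secondly, let [s] be followed by a cut and let [t] come
    after that cut. A shortest path from [v] to [X_t] contains some [X_r]
    visited during the cut, and [X_s] is at distance at most [r - s] from it, so
    [X_t] is farther from [v] than from [X_s] if [X_r] is farther than [r - s]
    from [v]. Therefore no pair of vertices different from [v] realises the
    diameter if every time [s] is followed by a cut within a waiting time that
    is shorter than the distance already gained from [v] ([Psi_prob_trace]).

    The trajectories of [good_trajectory] have this property at all scales
    [h = 2 ^ k]. From time [h ^ 14] up to the next scale there is a cut of width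
    [h ^ 10] at every multiple of [h ^ 10], so the waiting time is at most
    [2 h ^ 10]; and at least half of the [h ^ 12] multiples of [h ^ 2] below
    [h ^ 14] are cuts of width [h ^ 2], so the distance gained is at least
    [h ^ 12 / 2]. The property concerns the trajectory and not the number [n] of
    vertices, and it is inherited by every initial segment; that is why the
    final bound is uniform in [n].

    The probability of a good trajectory is bounded by first moments only. The
    walk is at a given vertex after [n] steps with probability
    [O (n ^ (- d / 2))] ([local_limit_bound]). Summing over pairs of times, for
    [d >= 5] a given time fails to be a cut of width [m] with probability
    [O (m ^ (- 1 / 2))] ([not_cut_bound]). At scale [h] there are [O (h ^ 4)]
    wide cuts, each failing with probability [O (h ^ - 5)], and Markov's
    inequality handles the narrow ones; in total the scale fails with
    probability [O (1 / h)]. The sum over all scales from [2 ^ k0] on is small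
    for large [k0]. The smaller scales are taken care of by prescribing the
    beginning of the walk: it goes straight during the first [2 (2 ^ k0) ^ 14]
    steps. The estimates above hold with the same constants for the walk with
    such a beginning ([collision_bound]), so at least half of these walks are
    good ([not_good_bound]), and the straight beginning has a positive
    probability that does not depend on [n]. *)

(** * Distances in finite graphs *)

Lemma bigminn_le (I : finType) (P : pred I) (F : I -> nat) b i :
  P i -> \big[minn/b]_(j | P j) F j <= F i.
Proof.
move=> Pi; have : i \in index_enum I by rewrite mem_index_enum.
elim: (index_enum I) => // j r IHr; rewrite inE big_cons.
case/orP => [/eqP <-|ir]; first by rewrite Pi geq_minl.
case: ifP => _; last exact: IHr.
by rewrite (leq_trans (geq_minr _ _)) ?IHr.
Qed.

Lemma bigminn_attained (I : finType) (P : pred I) (F : I -> nat) b :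
  \big[minn/b]_(j | P j) F j = b \/
  exists2 i, P i & \big[minn/b]_(j | P j) F j = F i.
Proof.
elim/big_ind: _ => [|m n hm hn|i Pi]; [by left| |by right; exists i].
by rewrite /minn; case: ltnP => _; [exact: hm | exact: hn].
Qed.

Section GraphDistance.
Variables (K : choiceType) (G : fsgraph K).
Implicit Types a b c : gverts G.
Let nV := #|{: gverts G}|.

(** This makes [gdist_le] valid for walks of any length, and it turns a large
    distance into a large number of vertices. *)
Lemma gdist_leV a b : gdist a b <= nV.
Proof.
rewrite /gdist; elim/big_ind: _ => // [m n hm _|i _].
  exact: leq_trans (geq_minl _ _) hm.
exact: ltnW.
Qed.

Lemma gdist_le a (p : seq (gverts G)) :
  path (@gadj K G) a p -> gdist a (last a p) <= size p.
Proof.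
move=> pth; have [lt|ge] := ltnP (size p) nV; last exact: leq_trans (gdist_leV _ _) ge.
apply: (@bigminn_le _ _ (fun k => val k) _ (Ordinal lt)); apply/existsP.
by exists (in_tuple p); rewrite /= pth eqxx.
Qed.

Definition joined a b :=
  exists2 p : seq (gverts G), path (@gadj K G) a p & last a p = b.

(** Deleting the loops of a shortest walk cannot shorten it, hence it may be
    taken simple. *)
Lemma gdist_path a b : joined a b ->
  exists p : seq (gverts G), [/\ path (@gadj K G) a p, last a p = b,
    size p = gdist a b & uniq (a :: p)].
Proof.
case=> p pth lst; case/shortenP: pth lst => q qp qu _ lst.
have szq : size q < nV.
  by move/card_uniqP: qu => /= <-; exact: max_card.
have lt : gdist a b < nV.
  by apply: leq_ltn_trans szq; rewrite -lst gdist_le.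
have [r [rp rl rs]] : exists r : seq (gverts G),
    [/\ path (@gadj K G) a r, last a r = b & size r = gdist a b].
  have := @bigminn_attained _ (fun k : 'I_nV => [exists p : k.-tuple (gverts G),
    path (@gadj K G) a p && (last a p == b)]) (@nat_of_ord _) nV.
  rewrite -/(gdist a b) => -[eqV|]; first by rewrite eqV ltnn in lt.
  case=> i /existsP[r /andP[rp /eqP rl]] ->; exists r; split=> //.
  exact: size_tuple.
have := rl; case/shortenP: (rp) => r' r'p r'u sub r'l.
exists r'; split=> //; apply/eqP; rewrite eqn_leq -{2}r'l gdist_le // andbT.
by rewrite -rs; apply: uniq_leq_size sub; case/andP: r'u.
Qed.

Lemma gadjC : symmetric (@gadj K G).
Proof. by move=> a b; rewrite /gadj fsetUC. Qed.

Lemma rev_walk a (p : seq (gverts G)) : path (@gadj K G) a p ->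
  exists q : seq (gverts G), [/\ path (@gadj K G) (last a p) q,
    last (last a p) q = a & size q = size p].
Proof.
move=> pp; exists (rev (belast a p)); split; last by rewrite size_rev size_belast.
  by rewrite rev_path; apply: sub_path pp => u w; rewrite gadjC.
by case: p {pp} => [|c p] //=; rewrite rev_cons last_rcons.
Qed.

Lemma gdistC a b : joined a b -> gdist a b = gdist b a.
Proof.
suff le c e : joined c e -> gdist e c <= gdist c e.
  move=> ab; apply/eqP; rewrite eqn_leq !le //.
  by have [p pp <-] := ab; have [q [qp ql _]] := rev_walk pp; exists q.
case/gdist_path=> p [pp <- <- _]; have [q [qp ql <-]] := rev_walk pp.
by rewrite -{2}ql gdist_le.
Qed.

Lemma gdist_triangle a b c : joined a b -> joined b c ->
  gdist a c <= gdist a b + gdist b c.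
Proof.
move=> /gdist_path[p [pp <- <- _]] /gdist_path[q [qp <- <- _]].
by rewrite -size_cat -last_cat gdist_le // cat_path pp.
Qed.

(** This is how the cuts of a trajectory will bound distances from below. *)
Lemma gdist_ge_level (l : gverts G -> nat) a b :
  (forall u w, gadj u w -> l w <= (l u).+1) -> joined a b ->
  l b <= l a + gdist a b.
Proof.
move=> hl /gdist_path[p [pp <- <- _]].
elim: p a pp => [|c p IHp] a /=; first by rewrite addn0.
by case/andP=> /hl ac /IHp; lia.
Qed.

Lemma gdist_le_gdiam a b : gdist a b <= gdiam G.
Proof.
rewrite /gdiam; apply: leq_trans (leq_bigmax a).
exact: (leq_bigmax (F := fun y => gdist a y)).
Qed.

(** Without this the average that defines [Psi_prob] would be an empty sum. *)
Lemma diametrical_paths_gt0 :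
  0 < nV -> (forall a b, joined a b) -> 0 < #|diametrical_paths G|.
Proof.
move=> V0 hj; have [x [y xy]] : exists x y : gverts G, gdist x y = gdiam G.
  rewrite /gdiam.
  have [x ->] := @bigop.eq_bigmax _ (fun x : {: gverts G} => \max_y gdist x y) V0.
  by have [y ->] := @bigop.eq_bigmax _ (fun y : {: gverts G} => gdist x y) V0; exists x, y.
have [p [pp pl ps pu]] := gdist_path (hj x y).
have szp : size (x :: p) == (gdiam G).+1 by rewrite /= ps xy.
apply/card_gt0P; exists (Tuple szp); rewrite inE /path_src /path_tgt.
have py : nth x (x :: p) (gdiam G) = y by rewrite -xy -ps -(last_nth x).
by apply/and3P; split=> //; rewrite !(tnth_nth x) /= py xy.
Qed.

(** Whatever diametrical path is drawn, [a] is one of its ends and wins the coin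
    toss with probability one half. *)
Lemma Psi_prob_ge_half (R : realType) a :
  (forall b c, joined b c) ->
  (forall b c, b != a -> c != a -> gdist b c < gdiam G) ->
  (1 / 2 <= Psi_prob G R (val a))%R.
Proof.
move=> hj far; rewrite /Psi_prob.
have D0 : 0 < #|diametrical_paths G|.
  by apply: diametrical_paths_gt0 => //; apply/card_gt0P; exists a.
apply: (@le_trans _ _ (\sum_(p in diametrical_paths G)
    #|diametrical_paths G|%:R^-1 * (1 / 2))%R).
  rewrite sumr_const -[leRHS]mulr_natl mulrA divff ?mul1r //.
  by rewrite pnatr_eq0 -lt0n.
apply: ler_sum => p; rewrite inE => /and3P[_ _ /eqP dp].
apply: ler_wpM2l; first by rewrite invr_ge0 ler0n.
rewrite !val_eqE.
have half0 (e : bool) : (0 <= e%:R / 2 :> R)%R by rewrite divr_ge0 ?ler0n.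
have [_|ns] := eqVneq (path_src p) a; first by rewrite lerDl.
have [_|nt] := eqVneq (path_tgt p) a; first by rewrite lerDr.
by have := far _ _ ns nt; rewrite dp ltnn.
Qed.

End GraphDistance.

(** * Cuts of a trajectory *)

(** The horizon [N] keeps this a condition on finitely many positions: the
    probability estimates are uniform in [N], and a trace of the walk up to a
    time [T <= N] sees the same cuts. *)
Definition cut_at (K : eqType) (x : nat -> K) (N t m : nat) : bool :=
  [forall i : 'I_t.+1, forall j : 'I_N.+1, (t + m <= j) ==> (x i != x j)].

Lemma cut_atP (K : eqType) (x : nat -> K) N t m :
  reflect (forall i j, i <= t -> t + m <= j -> j <= N -> x i <> x j)
    (cut_at x N t m).
Proof.
apply: (iffP forallP) => [h i j it tj jN|h i].
  have /forallP/(_ (inord j))/implyP := h (inord i).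
  by rewrite !inordK // => /(_ tj)/eqP.
by apply/forallP => j; apply/implyP => tj; apply/eqP/h => //; rewrite -ltnS.
Qed.

Lemma cut_at_leq (K : eqType) (x : nat -> K) N T t m :
  T <= N -> cut_at x N t m -> cut_at x T t m.
Proof.
move=> TN /cut_atP h; apply/cut_atP => i j it tj jT.
by apply: h => //; exact: leq_trans TN.
Qed.

Section TraceDistance.
Variables (K : choiceType) (x : nat -> K) (T : nat).
Let G := trace_graph x T.

Lemma mem_trace i : x (minn i T) \in gverts G.
Proof.
have h : minn i T \in iota 0 T.+1 by rewrite mem_iota ltnS geq_minr.
by apply/imfsetP; exists (minn i T).
Qed.

(** Times beyond [T] are truncated, which makes this a total function. *)
Definition vertex_at i : gverts G := [` mem_trace i]%fset.

Lemma val_vertex_at i : i <= T -> val (vertex_at i) = x i.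
Proof. by move=> iT; rewrite /= (minn_idPl iT). Qed.

Lemma vertex_atP (a : gverts G) : exists2 i, i <= T & a = vertex_at i.
Proof.
have /imfsetP[i iI e] := valP a.
have iT : i <= T by have : i \in iota 0 T.+1 := iI; rewrite mem_iota.
by exists i => //; apply: val_inj; rewrite val_vertex_at.
Qed.

Lemma gadj_step l : l < T ->
  gadj (vertex_at l) (vertex_at l.+1) /\ gadj (vertex_at l.+1) (vertex_at l).
Proof.
move=> lT; rewrite /gadj !val_vertex_at ?(ltnW lT) //.
suff h : [fset x l; x l.+1]%fset \in gedges G by split=> //; rewrite fsetUC.
have h : l \in iota 0 T by rewrite mem_iota.
by apply/imfsetP; exists l.
Qed.

Lemma gadj_trace (a b : gverts G) : gadj a b ->
  exists2 l, l < T & (a = vertex_at l /\ b = vertex_at l.+1) \/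
                     (a = vertex_at l.+1 /\ b = vertex_at l).
Proof.
case/imfsetP=> l lI e.
have lT : l < T by have : l \in iota 0 T := lI; rewrite mem_iota.
exists l => //.
have eqv (c : gverts G) k : k <= T -> val c = x k -> c = vertex_at k.
  by move=> kT ck; apply: val_inj; rewrite val_vertex_at.
have : val a \in [fset x l; x l.+1]%fset by rewrite -e !inE eqxx.
have : val b \in [fset x l; x l.+1]%fset by rewrite -e !inE eqxx orbT.
have : x l \in [fset val a; val b]%fset by rewrite e !inE eqxx.
have : x l.+1 \in [fset val a; val b]%fset by rewrite e !inE eqxx orbT.
rewrite !inE => /orP[]/eqP e1 /orP[]/eqP e2 /orP[]/eqP e3 /orP[]/eqP e4;
  solve [left; split; apply: eqv; (lia || congruence)
        | right; split; apply: eqv; (lia || congruence)].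
Qed.

Lemma trace_path s t : s <= t -> t <= T ->
  exists p : seq (gverts G), [/\ path (@gadj K G) (vertex_at s) p,
    last (vertex_at s) p = vertex_at t & size p = t - s].
Proof.
move=> st; elim: t st => [|t IHt] st tT.
  by exists [::]; split=> //; move: st; rewrite leqn0 => /eqP ->.
move: st; rewrite leq_eqVlt => /orP[/eqP ->|st].
  by exists [::]; split=> //; rewrite subnn.
have [p [pp pl ps]] := IHt st (ltnW tT).
exists (rcons p (vertex_at t.+1)); split; last 2 first.
- by rewrite last_rcons.
- by rewrite size_rcons ps subSn.
by rewrite rcons_path pp pl; case: (gadj_step tT).
Qed.

Lemma joined_trace (a b : gverts G) : joined a b.
Proof.
have [i iT ->] := vertex_atP a; have [j jT ->] := vertex_atP b.
have [ij|ji] := leqP i j; first by have [p [? ? _]] := trace_path ij jT; exists p.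
have [p [pp pl _]] := trace_path (ltnW ji) iT.
by have [q [qp ql _]] := rev_walk pp; rewrite pl in qp ql; exists q.
Qed.

Lemma gdist_trace s t : s <= t -> t <= T ->
  gdist (vertex_at s) (vertex_at t) <= t - s.
Proof. by move=> st tT; have [p [pp <- <-]] := trace_path st tT; exact: gdist_le. Qed.

Definition past t (a : gverts G) :=
  [exists i : 'I_t.+1, (i <= T) && (a == vertex_at i)].

Lemma pastP t a :
  reflect (exists i, [/\ i <= t, i <= T & a = vertex_at i]) (past t a).
Proof.
apply: (iffP existsP) => [[i /andP[iT /eqP ->]]|[i [it iT ->]]].
  by exists i; rewrite -ltnS.
by exists (Ordinal (it : i < t.+1)); rewrite /= iT eqxx.
Qed.

Lemma not_past_cut t m r : cut_at x T t m -> t + m <= r -> r <= T ->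
  ~~ past t (vertex_at r).
Proof.
move=> /cut_atP cut tr rT; apply/pastP => -[i [it iT ri]].
by apply: (cut i r) => //; rewrite -!val_vertex_at // ri.
Qed.

(** An edge traversed before the cut has both ends in the past of the cut, and
    one traversed after the cut has no end in the past. *)
Lemma edge_across_cut t m (a b : gverts G) l : cut_at x T t m -> l < T ->
  (a = vertex_at l /\ b = vertex_at l.+1) \/
  (a = vertex_at l.+1 /\ b = vertex_at l) ->
  past t a -> ~~ past t b -> t <= l < t + m.
Proof.
move=> cut lT ab pa /pastP pb; apply/andP; split.
  rewrite leqNgt; apply/negP => lt; apply: pb.
  by case: ab => -[_ ->]; [exists l.+1 | exists l]; split=> //; lia.
rewrite ltnNge; apply/negP => tl; apply/negP: pa.
by case: ab => -[-> _]; apply: not_past_cut cut _ _; lia.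
Qed.

(** Let the level of a vertex be the number of cuts of the grid whose past does
    not contain it. An edge traversed at time [l] can only cross the cut with
    index [l %/ m], so the level grows by at most one along an edge. *)
Lemma gdist_ge_cuts m n r : 0 < m -> n * m <= r -> r <= T ->
  #|[set i : 'I_n | cut_at x T (i * m) m]| <= gdist (vertex_at 0) (vertex_at r).
Proof.
move=> m0 nr rT.
pose S a := [set i : 'I_n | cut_at x T (i * m) m & ~~ past (i * m) a].
have S0 : S (vertex_at 0) = finset.set0.
  apply/setP => i; rewrite !inE; apply/negP => /andP[_ /negP]; apply.
  by apply/pastP; exists 0.
have Sr : S (vertex_at r) = [set i : 'I_n | cut_at x T (i * m) m].
  apply/setP => i; rewrite !inE; case cut: (cut_at _ _ _ _) => //=.
  apply: not_past_cut cut _ rT.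
  by rewrite addnC -mulSn (leq_trans _ nr) // leq_mul2r ltn_ord orbT.
rewrite -Sr; pose level a := #|S a|.
suff le1 a b : gadj a b -> level b <= (level a).+1.
  have := gdist_ge_level le1 (joined_trace (vertex_at 0) (vertex_at r)).
  by rewrite {2}/level S0 cards0.
move=> /gadj_trace[l lT ab]; rewrite /level -(finset.cardsID (S a) (S b)) -addn1.
apply: leq_add; first by apply: subset_leq_card; apply: finset.subsetIr.
apply/card_le1_eqP => i j.
have crossed k : k \in (S b :\: S a)%SET -> k = l %/ m :> nat.
  rewrite !inE negb_and negbK => /andP[+ /andP[cut pb]].
  rewrite cut /= => pa; have := edge_across_cut cut lT ab pa pb.
  rewrite addnC -mulSn => kl; apply/eqP.
  by rewrite eqn_leq leq_divRL // -[l %/ m <= k]ltnS ltn_divLR.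
by move=> /crossed ei /crossed ej; apply: val_inj; rewrite /= ei ej.
Qed.

(** The two ends of a shortest path are in the past and in the future of the
    cut, hence some vertex visited during the cut splits the path. *)
Lemma gdist_through_cut t m s : cut_at x T t m -> t + m <= s -> s <= T ->
  exists r, [/\ t <= r, r <= t + m, r <= T &
    gdist (vertex_at 0) (vertex_at s) =
    gdist (vertex_at 0) (vertex_at r) + gdist (vertex_at r) (vertex_at s)].
Proof.
move=> cut ts sT.
have [p [pp pl ps _]] := gdist_path (joined_trace (vertex_at 0) (vertex_at s)).
have past0 : past t (vertex_at 0) by apply/pastP; exists 0.
have npast : ~~ past t (last (vertex_at 0) p) by rewrite pl (not_past_cut cut).
have [q1 [b [q2 [ep pa pb]]]] : exists q1 b q2, [/\ p = q1 ++ b :: q2,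
    past t (last (vertex_at 0) q1) & ~~ past t b].
  elim: p (vertex_at 0) {pp pl ps} past0 npast => [|c p IHp] a pa /=.
    by rewrite pa.
  move=> npl; have [pc|npc] := boolP (past t c).
    by have [q1 [b [q2 [-> ? ?]]]] := IHp c pc npl; exists (c :: q1), b, q2.
  by exists [::], c, p.
move: pp pl ps; rewrite ep cat_path last_cat size_cat /= => /and3P[p1 ab p2] pl ps.
have [l lT abl] := gadj_trace ab.
have /andP[tl lm] := edge_across_cut cut lT abl pa pb.
have [r [tr rm rT er]] : exists r, [/\ t <= r, r <= t + m, r <= T &
    last (vertex_at 0) q1 = vertex_at r].
  by case: abl => -[-> _]; [exists l | exists l.+1]; split=> //; lia.
exists r; split=> //; apply/eqP; rewrite eqn_leq.
rewrite gdist_triangle ?andbT //=; try exact: joined_trace.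
rewrite -{}ps -er leq_add ?gdist_le // -pl.
by apply: (@gdist_le _ _ _ (b :: q2)); rewrite /= ab.
Qed.

(** If [t] comes after the cut, a shortest path from the origin to the vertex
    visited at time [t] passes through the cut, where the origin is farther
    away than the vertex visited at time [s]. If [t] comes before the end of
    the cut, the bound [r - s] applies with [r = t]. *)
Lemma gdist_origin_wins s t u m : cut_at x T u m -> s <= u ->
  (forall r, s <= r -> r <= u + m -> r <= T ->
     r - s < gdist (vertex_at 0) (vertex_at r)) ->
  s <= t -> t <= T ->
  gdist (vertex_at s) (vertex_at t) < gdist (vertex_at 0) (vertex_at t).
Proof.
move=> cut su far st tT; have [ut|tu] := leqP (u + m) t; last first.
  by apply: leq_ltn_trans (gdist_trace st tT) (far _ _ _ _) => //; exact: ltnW.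
have [r [ur rm rT ->]] := gdist_through_cut cut ut tT.
have sr := leq_trans su ur.
have := gdist_trace sr rT; have := far r sr rm rT.
have := gdist_triangle (joined_trace (vertex_at s) (vertex_at r))
                       (joined_trace (vertex_at r) (vertex_at t)).
lia.
Qed.

(** A vertex other than the origin is visited at a positive time; of two such
    vertices, the one visited later is farther from the origin than from the
    other, so their distance is smaller than the diameter. *)
Lemma Psi_prob_trace (R : realType) :
  (forall s, 0 < s <= T -> exists u m, [/\ s <= u, cut_at x T u m &
    forall r, s <= r -> r <= u + m -> r <= T ->
      r - s < gdist (vertex_at 0) (vertex_at r)]) ->
  (1 / 2 <= Psi_prob G R (x 0))%R.
Proof.
move=> h; rewrite -[x 0](val_vertex_at (leq0n T)).
apply: Psi_prob_ge_half => [|a b]; first exact: joined_trace.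
have [s sT ->] := vertex_atP a; have [t tT ->] := vertex_atP b.
wlog st : s t sT tT / s <= t.
  move=> hw; have [/hw|ts] := leqP s t; first exact.
  by move=> na nb; rewrite (gdistC (joined_trace _ _)) (hw t s) // ltnW.
case: s st sT => [|s] st sT; first by rewrite eqxx.
move=> _ _; have [u [m [su cut far]]] := h s.+1 sT.
exact: leq_trans (gdist_origin_wins cut su far st tT) (gdist_le_gdiam _ _).
Qed.
End TraceDistance.

(** * Good trajectories *)

(** Consecutive scales [h] and [2 h] bound the times between [h ^ 14] and
    [2 ^ 14 * h ^ 14], which contain about [2 ^ 14 * h ^ 4] multiples of
    [h ^ 10]. The exponents leave room on both sides: [h ^ 4] is smaller than
    [h ^ 5], the square root of the width, which makes it unlikely that one of
    the windows fails; and [h ^ 10] is smaller than the number [h ^ 12] of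
    narrow cuts that push the walk away from its origin. *)
Definition window_cuts (K : eqType) (x : nat -> K) (N k : nat) : bool :=
  [forall i : 'I_(2 ^ 14 * (2 ^ k) ^ 4).+1,
     cut_at x N (i * (2 ^ k) ^ 10) ((2 ^ k) ^ 10)].

Definition many_cuts (K : eqType) (x : nat -> K) (N k : nat) : bool :=
  (2 ^ k) ^ 12 <= 2 * #|[set i : 'I_((2 ^ k) ^ 12) |
    cut_at x N (i * (2 ^ k) ^ 2) ((2 ^ k) ^ 2)]|.

(** The times before the first scale are left to the straight beginning of the
    walk, where each of them is a cut of width one. *)
Definition good_trajectory (K : eqType) (x : nat -> K) (N k0 : nat) : bool :=
  [forall t : 'I_((2 ^ k0) ^ 14), cut_at x N t 1] &&
  [forall k : 'I_N.+1, (k0 <= k) ==> window_cuts x N k && many_cuts x N k].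

Lemma good_trajectoryP (K : eqType) (x : nat -> K) N k0 :
  good_trajectory x N k0 ->
  (forall t, t < (2 ^ k0) ^ 14 -> cut_at x N t 1) /\
  (forall k, k0 <= k <= N -> window_cuts x N k && many_cuts x N k).
Proof.
case/andP=> /forallP hA /forallP hB; split=> [t lt|k /andP[k0k kN]].
  exact: (hA (Ordinal lt)).
exact: (implyP (hB (Ordinal (kN : k < N.+1)))).
Qed.

(** Only the coincidences of positions matter, so translating the walk or
    changing it after the horizon is harmless. *)
Lemma eq_good_trajectory (K K' : eqType) (x : nat -> K) (y : nat -> K') N k0 :
  (forall i j, i <= N -> j <= N -> (x i == x j) = (y i == y j)) ->
  good_trajectory x N k0 = good_trajectory y N k0.
Proof.
move=> xy; have eqc t m : cut_at x N t m = cut_at y N t m.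
  apply: eq_forallb => i; apply: eq_forallb => j; case: leqP => //= tj.
  have jN : j <= N by rewrite -ltnS.
  by rewrite xy //; have := ltn_ord i; lia.
congr (_ && _); apply: eq_forallb => k; first exact: eqc.
congr (_ ==> (_ && _)); first by apply: eq_forallb => i; exact: eqc.
congr (_ <= 2 * _); apply: eq_card => i; rewrite !inE; exact: eqc.
Qed.

Section GoodTrajectory.
Variables (K : choiceType) (x : nat -> K) (N k0 : nat).
Hypothesis k0_ge2 : 2 <= k0.
Hypothesis x_good : good_trajectory x N k0.
Let good := good_trajectoryP x_good.

Lemma good_gdist k T r : k0 <= k <= N -> T <= N -> (2 ^ k) ^ 14 <= r -> r <= T ->
  (2 ^ k) ^ 12 <= 2 * gdist (vertex_at x T 0) (vertex_at x T r).
Proof.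
move=> kN TN kr rT; have /andP[_ /leq_trans] := good.2 k kN; apply.
rewrite leq_mul2l /=; set h := 2 ^ k.
have h0 : 0 < h ^ 2 by rewrite !expn_gt0.
have hr : h ^ 12 * h ^ 2 <= r by rewrite -expnD.
apply: leq_trans _ (gdist_ge_cuts x h0 hr rT).
apply: subset_leq_card; apply/fintype.subsetP => i; rewrite !inE.
exact: cut_at_leq.
Qed.

Lemma good_Psi_prob (R : realType) T : T <= N ->
  (1 / 2 <= Psi_prob (trace_graph x T) R (x 0))%R.
Proof.
move=> TN; apply: Psi_prob_trace => s /andP[s0 sT].
have [sS|Ss] := ltnP s ((2 ^ k0) ^ 14).
  (* Along the first segment the distance from the origin is the time. *)
  exists s, 1; split=> //; first by apply: cut_at_leq TN _; exact: good.1.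
  move=> r sr rs rT; apply: (@leq_trans r); first by lia.
  have r1 : r * 1 <= r by rewrite muln1.
  apply: leq_trans _ (gdist_ge_cuts x (ltn0Sn 0) r1 rT).
  rewrite -{1}[r]card_ord -cardsT; apply: subset_leq_card.
  apply/fintype.subsetP => i _; rewrite inE muln1; apply: cut_at_leq TN _.
  by apply: good.1; have := ltn_ord i; lia.
have e j : (2 ^ j) ^ 14 = (2 ^ 14) ^ j by rewrite -!expnM mulnC.
have p1 : 1 < 2 ^ 14 by rewrite -{1}(expn0 2) ltn_exp2l.
pose k := trunc_log (2 ^ 14) s; set h := 2 ^ k.
have /andP[ks sk] : (2 ^ k) ^ 14 <= s < (2 ^ k.+1) ^ 14.
  by rewrite !e trunc_logP // trunc_log_ltn.
have k0k : k0 <= k.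
  by rewrite /k trunc_log_max // -e.
have kN : k <= N.
  apply: leq_trans (leq_trans sT TN); apply: leq_trans ks.
  rewrite -expnM; apply: leq_trans (ltnW (ltn_expl _ (ltnSn 1))) _.
  by rewrite leq_exp2l //; lia.
have kk : k0 <= k <= N by rewrite k0k.
have h16 : 2 ^ 4 <= h ^ 2 by rewrite -expnM leq_exp2l //; lia.
have m0 : 0 < h ^ 10 by rewrite !expn_gt0.
have iW : (s %/ h ^ 10).+1 < (2 ^ 14 * h ^ 4).+1.
  by rewrite ltnS ltn_divLR // -mulnA -expnD -expnMn -expnS.
have /andP[/forallP/(_ (Ordinal iW))/= cut _] := good.2 k kk.
(* The next multiple of [h ^ 10]; its cut ends by the time [s + 2 * h ^ 10]. *)
exists ((s %/ h ^ 10).+1 * h ^ 10), (h ^ 10).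
have lt := ltn_ceil s m0; have le := leq_trunc_div s (h ^ 10).
split; [exact: ltnW | exact: cut_at_leq TN cut |].
move=> r sr; rewrite mulSn => rs rT.
have := good_gdist kk TN (leq_trans ks sr) rT; rewrite -/h.
have -> : 12 = 10 + 2 by [].
rewrite expnD; move: (h ^ 10) (h ^ 2) h16 m0 le rs => a b; nia.
Qed.

Lemma card_trace_step T :
  #|` gverts (trace_graph x T.+1)| <= #|` gverts (trace_graph x T)|.+1.
Proof.
have -> : gverts (trace_graph x T.+1) = (x T.+1 |` gverts (trace_graph x T))%fset.
  apply/fsetP => y; rewrite in_fset1U.
  apply/idP/idP => [/imfsetP[i iI ->]|/orP[/eqP ->|/imfsetP[i iI ->]]].
  - have : i \in iota 0 T.+2 := iI.
    rewrite mem_iota ltnS leq0n /= leq_eqVlt.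
    case/orP=> [/eqP ->|lt]; first by rewrite eqxx.
    have iT : i \in iota 0 T.+1 by rewrite mem_iota.
    by apply/orP; right; apply/imfsetP; exists i.
  - have iT : T.+1 \in iota 0 T.+2 by rewrite mem_iota ltnS leqnn.
    by apply/imfsetP; exists T.+1.
  - have : i \in iota 0 T.+1 := iI; rewrite mem_iota => iT.
    have iT' : i \in iota 0 T.+2 by rewrite mem_iota; lia.
    by apply/imfsetP; exists i.
by rewrite cardfsU1; case: (_ \notin _) => //=; rewrite addnC addn1.
Qed.

(** A good trajectory moves far away from its origin, so it visits many
    vertices; as it visits at most one new vertex per step, it visits exactly
    [n] of them at some time before the horizon. *)
Lemma good_range_graph n k : 0 < n -> k0 <= k <= N -> (2 ^ k) ^ 14 <= N ->
  2 * n <= (2 ^ k) ^ 12 ->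
  exists2 T, T <= N & range_graph x n = Some (trace_graph x T).
Proof.
move=> n0 kN Nk nk.
pose v T := #|` gverts (trace_graph x T)|.
have vN : n <= v N.
  have := good_gdist kN (leqnn N) Nk (leqnn N).
  have := gdist_leV (vertex_at x N 0) (vertex_at x N N).
  by rewrite -cardfE -/(v N); lia.
have [t tN vt] : exists2 t, t <= N & v t = n.
  elim: N vN => [|M IHM] vM.
    exists 0 => //; apply/eqP; rewrite eqn_leq vM andbT.
    apply: leq_trans n0; rewrite /v -(cardfs1 (x 0)).
    apply: fsubset_leq_card; apply/fsubsetP => y /imfsetP[i iI ->].
    have : i \in [:: 0] := iI; rewrite mem_seq1 => /eqP ->.
    by rewrite in_fset1.
  have [/IHM[t tM vt]|lt] := leqP n (v M); first by exists t => //; exact: leqW.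
  exists M.+1 => //; have := card_trace_step M; rewrite -/(v M) -/(v M.+1); lia.
have ex : exists t, #|` gverts (trace_graph x t)| == n by exists t; apply/eqP.
rewrite /range_graph /range_time; case: pselect => [h|//] /=.
exists (ex_minn h) => //; case: ex_minnP => u _ /(_ t).
by rewrite -/(v t) vt eqxx => /(_ isT)/leq_trans; apply.
Qed.

End GoodTrajectory.

Local Open Scope ring_scope.

(** * Sums over words *)

Section Words.
Variables (D : finType) (V : nmodType).
Implicit Type F : seq D -> V.

Lemma sum_tuple0 F : \sum_(s : 0.-tuple D) F s = F [::].
Proof.
rewrite (bigD1 [tuple]) //= big1 ?addr0 // => s /eqP[].
exact: tuple0.
Qed.

Lemma sum_tuple_cons n F :
  \sum_(s : n.+1.-tuple D) F s = \sum_a \sum_(s : n.-tuple D) F (a :: s).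
Proof.
rewrite pair_bigA /= (reindex (fun p : D * n.-tuple D => cons_tuple p.1 p.2)) //=.
exists (fun t : n.+1.-tuple D => (thead t, behead_tuple t)) => [[a s] _|t _].
  by congr pair; apply: val_inj.
by rewrite [in RHS](tuple_eta t); apply: val_inj.
Qed.

Lemma sum_tuple_take n N F : (n <= N)%N ->
  \sum_(s : N.-tuple D) F (take n s) =
  (\sum_(s : n.-tuple D) F s) *+ #|D| ^ (N - n).
Proof.
elim: n N F => [|n IHn] N F.
  move=> _; under eq_bigr do rewrite take0.
  by rewrite sumr_const card_tuple subn0 sum_tuple0.
case: N => // N nN; rewrite (sum_tuple_cons _ (fun s => F (take n.+1 s))).
rewrite sum_tuple_cons -sumrMnl; apply: eq_bigr => a _ /=.
by rewrite subSS (IHn N (fun s => F (a :: s))).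
Qed.

Lemma sum_tuple_rot n m F :
  \sum_(s : n.-tuple D) F (rot m s) = \sum_(s : n.-tuple D) F s.
Proof.
rewrite [RHS](reindex (fun s : n.-tuple D => [tuple of rot m s])) //=.
exists (fun s : n.-tuple D => [tuple of rotr m s]) => s _; apply: val_inj => /=.
  exact: rotK.
exact: rotrK.
Qed.

(** Rotating the words moves the infix to the front. *)
Lemma sum_tuple_infix a b N F : (a <= b)%N -> (b <= N)%N ->
  \sum_(s : N.-tuple D) F (drop a (take b s)) =
  (\sum_(s : (b - a).-tuple D) F s) *+ #|D| ^ (N - (b - a)).
Proof.
move=> ab bN; rewrite -sum_tuple_take; last by lia.
rewrite -[RHS](sum_tuple_rot _ a (fun s => F (take (b - a) s))).
apply: eq_bigr => s _; congr F; rewrite /rot take_cat size_drop size_tuple.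
case: ltnP => ?; first by rewrite take_drop subnK.
have -> : b = N by lia.
by rewrite subnn take0 cats0 take_oversize ?size_tuple.
Qed.

End Words.

Section Occupation.
Variables (D : finType) (R : numFieldType).

(** Marking one of the occurrences of a letter in a word of length [n.+1] is
    the same as inserting that letter into a word of length [n] at one of
    [n.+1] places. *)
Lemma sum_count_mem n (a : D) (F : seq D -> R) :
  (forall s t, perm_eq s t -> F s = F t) ->
  \sum_(t : n.+1.-tuple D) (count_mem a t)%:R * F t =
  n.+1%:R * \sum_(s : n.-tuple D) F (a :: s).
Proof.
move=> symF.
have cnt (t : n.+1.-tuple D) :
    (count_mem a t)%:R = \sum_(i < n.+1) (nth a t i == a)%:R :> R.
  rewrite -sum1_count big_mkcond natr_sum.
  by rewrite (big_nth a) big_mkord size_tuple; apply: eq_bigr => i _ /=; case: (_ == _).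
under eq_bigr do rewrite cnt mulr_suml.
rewrite exchange_big /= -[n.+1 in RHS]card_ord -sum1_card natr_sum mulr_suml.
apply: eq_bigr => i _; rewrite mul1r.
transitivity (\sum_(t : n.+1.-tuple D) (head a (rot i t) == a)%:R * F (rot i t)).
  apply: eq_bigr => t _; rewrite -nth0 nth_cat size_drop size_tuple subn_gt0.
  rewrite ltn_ord nth_drop addn0; congr (_ * _); apply: symF.
  by rewrite perm_sym perm_rot.
rewrite (sum_tuple_rot _ _ (fun t => (head a t == a)%:R * F t)).
rewrite (sum_tuple_cons _ (fun t => (head a t == a)%:R * F t)) (bigD1 a) //=.
rewrite [X in _ + X]big1 => [|b /negPf nb].
  by rewrite addr0; apply: eq_bigr => s _; rewrite eqxx mul1r.
by apply: big1 => s _; rewrite nb mul0r.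
Qed.

(** Divided by [#|D| ^ n], the left side is the mean of a product over the
    components of a multinomial vector, and it has the same order of magnitude
    as if these components stayed at their means. By [sum_count_mem] each factor
    is absorbed by inserting one more letter, which lengthens the words by
    one. *)
Lemma sum_prod_occupation n (rs : seq D) : uniq rs ->
  \sum_(c : n.-tuple D) \prod_(r <- rs) (count_mem r c).+1%:R^-1 <=
  #|D|%:R ^+ (n + size rs) / n.+1%:R ^+ size rs :> R.
Proof.
elim: rs n => [|a rs IHrs] n /=.
  move=> _; under eq_bigr do rewrite big_nil.
  by rewrite sumr_const card_tuple addn0 divr1 natrX.
case/andP=> ars /IHrs{IHrs} IH.
pose F (s : seq D) : R := \prod_(r <- rs) (count_mem r s).+1%:R^-1.
have F0 s : 0 <= F s by apply: prodr_ge0 => r _; rewrite invr_ge0 ler0n.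
have Fa s : F (a :: s) = F s.
  apply: eq_big_seq => r rrs; rewrite /=; case: eqP => [ar|//].
  by rewrite ar rrs in ars.
have n0 : 0 < n.+1%:R :> R by rewrite ltr0n.
have := @sum_count_mem n a (fun s => F s / (count_mem a s)%:R) _.
have -> : \sum_(s : n.-tuple D) F (a :: s) / (count_mem a (a :: s))%:R =
    \sum_(c : n.-tuple D) \prod_(r <- a :: rs) (count_mem r c).+1%:R^-1.
  by apply: eq_bigr => s _; rewrite Fa big_cons /= eqxx mulrC.
move=> eqn; have {eqn}/(_ _)/esym eqn := eqn.
rewrite exprS invfM mulrCA ler_pdivlMl // eqn; last first.
  by move=> s t st; rewrite /F (permP st); congr (_ / _); apply: eq_bigr => r _; rewrite (permP st).
apply: le_trans (_ : \sum_(t : n.+1.-tuple D) F t <= _).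
  apply: ler_sum => t _; have [->|c0] := posnP (count_mem a t); first by rewrite mul0r.
  by rewrite mulrCA divff ?mulr1 // pnatr_eq0 -lt0n.
apply: le_trans (IH n.+1) _; rewrite addSnnS ler_wpM2l ?exprn_ge0 ?ler0n //.
by rewrite lef_pV2 ?posrE ?exprn_gt0 ?ltr0n // lerXn2r ?nnegrE ?ler0n // ler_nat.
Qed.

End Occupation.

(** * A local limit bound for the simple random walk *)

Lemma bin_le_central k i : ('C(k, i) <= 'C(k, k./2))%N.
Proof.
have up j : (j.*2 < k)%N -> ('C(k, j) <= 'C(k, j.+1))%N.
  move=> jk; rewrite -(leq_pmul2l (ltn0Sn j)) mul_bin_left leq_mul2r.
  by apply/orP; right; lia.
have low j : (j <= k./2)%N -> ('C(k, j) <= 'C(k, k./2))%N.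
  move=> jk; rewrite -(subKn jk); elim: (k./2 - j)%N => [|m IHm]; first by rewrite subn0.
  have [mk|km] := ltnP m k./2; last by have -> : (k./2 - m.+1 = k./2 - m)%N by lia.
  apply: leq_trans IHm; have -> : (k./2 - m = (k./2 - m.+1).+1)%N by lia.
  by apply: up; lia.
have [ki|ik] := ltnP k i; first by rewrite bin_small.
have [|ki] := leqP i k./2; first exact: low.
by rewrite -bin_sub //; apply: low; lia.
Qed.

(** Induction along the central binomial coefficients of even and odd rows, by
    the ratio of two consecutive ones; the step amounts to
    [(2 j + 1) (2 j + 3) <= (2 j + 2) ^ 2]. *)
Lemma central_bin_bound j :
  ('C(j.*2, j) ^ 2 * (j.*2).+1 <= 16 ^ j)%N /\
  ('C((j.*2).+1, j) ^ 2 * (j.*2).+2 <= 4 * 16 ^ j)%N.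
Proof.
have mid i : ((i.*2).+1 * 'C(i.*2, i) = i.+1 * 'C((i.*2).+1, i))%N.
  by have := mul_bin_down (i.*2).+1 i; rewrite -pred_Sn => ->; congr (_ * _)%N; lia.
have odd i : ('C(i.*2, i) ^ 2 * (i.*2).+1 <= 16 ^ i ->
    'C((i.*2).+1, i) ^ 2 * (i.*2).+2 <= 4 * 16 ^ i)%N.
  move: (mid i) => /(congr1 (fun n => n ^ 2)%N); rewrite !expnMn => e le.
  rewrite -(@leq_pmul2l (i.+1 ^ 2)) ?expn_gt0 // mulnA -e.
  by move: ('C(_, _)) (16 ^ i)%N le => a p le; nia.
suff ev : ('C(j.*2, j) ^ 2 * (j.*2).+1 <= 16 ^ j)%N by split=> //; exact: odd.
elim: j => [|i IHi]; first by [].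
have e2 : 'C(i.+1.*2, i.+1) = (2 * 'C((i.*2).+1, i))%N.
  rewrite doubleS binS mulSn mul1n; congr (_ + _)%N.
  by rewrite -[in LHS]bin_sub; [congr 'C(_, _); lia | lia].
rewrite e2 (expnS 16); move: (mid i) => /(congr1 (fun n => n ^ 2)%N); rewrite !expnMn => e.
rewrite -(@leq_pmul2l (i.+1 ^ 2)) ?expn_gt0 //.
have -> : (i.+1 ^ 2 * (2 ^ 2 * 'C((i.*2).+1, i) ^ 2 * (i.+1.*2).+1) =
  4 * (i.+1.*2).+1 * (i.+1 ^ 2 * 'C((i.*2).+1, i) ^ 2))%N by ring.
rewrite -e; move: ('C(_, _)) (16 ^ i)%N IHi => a p le.
by rewrite doubleS; nia.
Qed.

Lemma bin_sqr_bound k i : ('C(k, i) ^ 2 * k.+1 <= 4 ^ k)%N.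
Proof.
apply: (@leq_trans ('C(k, k./2) ^ 2 * k.+1)).
  by rewrite leq_mul2r leq_exp2r // bin_le_central.
have [ev od] := central_bin_bound k./2; have e4 : (16 = 4 ^ 2)%N by [].
rewrite -{1 3 4}[k]odd_double_half; case: (odd k); rewrite ?add0n ?add1n.
  by apply: leq_trans od _; rewrite e4 -expnM -expnS mul2n.
by apply: leq_trans ev _; rewrite e4 -expnM mul2n.
Qed.

(** The number of walks on the integers that end in [y] after [k] steps. *)
Fixpoint sign_words (k : nat) (y : int) : nat :=
  if k is k'.+1 then (sign_words k' (y - 1) + sign_words k' (y + 1))%N
  else y == 0.

Lemma sign_words_bin k y : exists i, (sign_words k y <= 'C(k, i))%N.
Proof.
have [hb h0] : (forall i : nat, sign_words k (i.*2%:Z - k%:Z) = 'C(k, i)) /\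
    (forall z, (forall i : nat, z <> i.*2%:Z - k%:Z) -> sign_words k z = 0%N).
  elim: k {y} => [|k [IHb IH0]] /=; split.
  - by case=> [|i] //=; rewrite subr0 bin_small.
  - by move=> z /(_ 0%N); rewrite subr0 => /eqP/negPf ->.
  - case=> [|i].
      rewrite IH0 => [|i]; last by lia.
      by rewrite (_ : _ + 1 = 0%N.*2%:Z - k%:Z) ?IHb ?bin0 //; lia.
    rewrite binS addnC -!IHb; congr (_ + _)%N; congr sign_words; lia.
  - move=> z hz; rewrite !IH0 // => i e; [apply: (hz i) | apply: (hz i.+1)]; lia.
pose i := (absz (y + k%:Z))./2.
have [e|ne] := eqVneq y (i.*2%:Z - k%:Z); first by exists i; rewrite e hb.
exists 0%N; rewrite h0 // => j e; case/eqP: ne; rewrite e; congr (_.*2%:Z - _).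
by rewrite /i e subrK /= doubleK.
Qed.

Lemma sign_words_sqr_bound k y : (sign_words k y ^ 2 * k.+1 <= 4 ^ k)%N.
Proof.
have [i le] := sign_words_bin k y; apply: leq_trans (bin_sqr_bound k i).
by rewrite leq_mul2r leq_exp2r // le.
Qed.

Section LocalLimit.
Variables (R : rcfType) (d : nat).

Definition step_vector (a : 'I_d * bool) : 'rV[int]_d :=
  (-1) ^+ a.2 *: delta_mx 0 a.1.

Definition displacement (s : seq ('I_d * bool)) : 'rV[int]_d :=
  \sum_(a <- s) step_vector a.

Definition inv_sqrt (n : nat) : R := (Num.sqrt n%:R)^-1.

Lemma inv_sqrt_ge0 n : 0 <= inv_sqrt n.
Proof. by rewrite invr_ge0 sqrtr_ge0. Qed.

Lemma sqr_inv_sqrt n : inv_sqrt n ^+ 2 = n%:R^-1.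
Proof. by rewrite exprVn sqr_sqrtr ?ler0n. Qed.

(** Choose first which coordinate each step changes, then the signs. *)
Lemma count_displacement n (x : 'rV[int]_d) :
  \sum_(s : n.-tuple ('I_d * bool)%type) (displacement s == x)%:R =
  \sum_(c : n.-tuple 'I_d)
     \prod_(r < d) (sign_words (count_mem r c) (x 0 r))%:R :> R.
Proof.
elim: n x => [|n IHn] x.
  rewrite (sum_tuple0 (fun s => (displacement s == x)%:R)).
  rewrite (sum_tuple0 (fun c => \prod_r (sign_words (count_mem r c) (x 0 r))%:R)).
  rewrite /displacement big_nil /= eq_sym; have [->|] := eqVneq x 0.
    by rewrite big1 // => r _; rewrite mxE eqxx.
  case/rV0Pn=> r xr; rewrite (bigD1 r) //=.
  by rewrite (negPf xr) mul0r.
rewrite (sum_tuple_cons _ (fun s => (displacement s == x)%:R)).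
rewrite (sum_tuple_cons _
  (fun c => \prod_r (sign_words (count_mem r c) (x 0 r))%:R)).
transitivity (\sum_(a : 'I_d * bool) \sum_(s : n.-tuple ('I_d * bool)%type)
    (displacement s == x - step_vector a)%:R : R).
  apply: eq_bigr => a _; apply: eq_bigr => s _; rewrite /displacement big_cons.
  by rewrite [in RHS]eq_sym subr_eq eq_sym addrC.
under eq_bigr do rewrite IHn.
rewrite -(pair_bigA _ (fun r b => \sum_(c : n.-tuple 'I_d) \prod_(r' < d)
  (sign_words (count_mem r' c) ((x - step_vector (r, b)) 0 r'))%:R)) /=.
apply: eq_bigr => r _; rewrite exchange_big; apply: eq_bigr => c _ /=.
rewrite (bigD1 r) //= big_bool /= (bigD1 r) //= [X in _ + X](bigD1 r) //=.
have same b : \prod_(r' < d | r' != r)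
     (sign_words (count_mem r' c) ((x - step_vector (r, b)) 0 r'))%:R =
   \prod_(r' < d | r' != r) (sign_words ((r == r') + count_mem r' c) (x 0 r'))%:R :> R.
  apply: eq_bigr => r' /negPf nr; rewrite eq_sym nr add0n.
  by rewrite !mxE nr andbF mulr0 subr0.
rewrite !same -mulrDl eqxx add1n /= natrD addrC; congr ((_ + _) * _).
  by rewrite !mxE !eqxx /= expr0 !mulr1.
by rewrite !mxE !eqxx /= expr1 !mulr1 opprK.
Qed.

Lemma sum_count_mem_size (c : seq 'I_d) : (\sum_(r < d) count_mem r c = size c)%N.
Proof.
elim: c => [|a c IHc] /=; first by rewrite big1.
by rewrite big_split /= IHc (bigD1 a) //= eqxx big1 // => r /negPf; rewrite eq_sym => ->.
Qed.

(** Given how often each coordinate changes, the coordinates are independent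
    walks on the integers, each with point probabilities at most
    [(k + 1) ^ (- 1 / 2)] after [k] changes. By [sum_prod_occupation] the
    product [y] of these bounds has a mean square of at most [l ^ 2], and the
    inequality [2 l y <= y ^ 2 + l ^ 2] turns this into a bound by [l] for its
    mean. *)
Theorem local_limit_bound n (x : 'rV[int]_d) : (0 < d)%N ->
  \sum_(s : n.-tuple ('I_d * bool)%type) (displacement s == x)%:R <=
  (2 * d)%:R ^+ n * (Num.sqrt d%:R * inv_sqrt n.+1) ^+ d :> R.
Proof.
move=> d0; rewrite count_displacement.
pose y (c : seq 'I_d) : R := \prod_(r < d) inv_sqrt (count_mem r c).+1.
have y0 c : 0 <= y c by apply: prodr_ge0 => r _; exact: inv_sqrt_ge0.
have sgn k z : (sign_words k z)%:R <= 2 ^+ k * inv_sqrt k.+1 :> R.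
  rewrite -(@ler_pXn2r _ 2) ?nnegrE ?ler0n ?mulr_ge0 ?exprn_ge0 ?ler0n ?inv_sqrt_ge0 //.
  have -> : (2 ^+ k * inv_sqrt k.+1) ^+ 2 = (4 ^ k)%:R / k.+1%:R :> R.
    by rewrite exprMn sqr_inv_sqrt exprAC natrX -[2 ^+ 2]natrX.
  rewrite ler_pdivlMr ?ltr0n // -natrX -natrM ler_nat.
  exact: sign_words_sqr_bound.
have cy (c : n.-tuple 'I_d) :
    \prod_(r < d) (sign_words (count_mem r c) (x 0 r))%:R <= 2 ^+ n * y c.
  apply: le_trans (_ : \prod_(r < d) (2 ^+ count_mem r c * inv_sqrt (count_mem r c).+1) <= _).
    by apply: ler_prod => r _; rewrite ler0n sgn.
  rewrite big_split /=; suff -> : \prod_(r < d) 2 ^+ count_mem r c = 2 ^+ n :> R by [].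
  by rewrite prodrXr sum_count_mem_size size_tuple.
apply: le_trans (ler_sum _ (fun c _ => cy c)) _.
rewrite -mulr_sumr natrM exprMn -mulrA ler_wpM2l ?exprn_ge0 ?ler0n //.
set l := (_ * _) ^+ d.
have l0 : 0 < l by rewrite exprn_gt0 // mulr_gt0 ?invr_gt0 ?sqrtr_gt0 ?ltr0n.
have l2 : l ^+ 2 = d%:R ^+ d / n.+1%:R ^+ d.
  rewrite /l exprAC [(_ * _) ^+ 2]exprMn sqr_inv_sqrt sqr_sqrtr ?ler0n //.
  by rewrite exprMn exprVn.
have Y2 : \sum_(c : n.-tuple 'I_d) y c ^+ 2 <= d%:R ^+ n * l ^+ 2.
  have := sum_prod_occupation R n (index_enum_uniq 'I_d).
  have -> : size (index_enum 'I_d) = d by rewrite [index_enum _]unlock -enumT -cardT card_ord.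
  rewrite card_ord exprD l2 mulrA; apply: le_trans.
  by apply: ler_sum => c _; rewrite /y -prodrXl; under eq_bigr do rewrite sqr_inv_sqrt.
have AG : \sum_(c : n.-tuple 'I_d) 2 * l * y c <=
    \sum_(c : n.-tuple 'I_d) (y c ^+ 2 + l ^+ 2).
  by apply: ler_sum => c _; have := sqr_ge0 (y c - l); nra.
rewrite -mulr_sumr big_split /= sumr_const card_tuple card_ord -[l ^+ 2 *+ _]mulr_natl in AG.
rewrite natrX in AG; rewrite -(@ler_pM2l _ (2 * l)); last by rewrite mulr_gt0.
apply: le_trans AG _.
have -> : 2 * l * (d%:R ^+ n * l) = d%:R ^+ n * l ^+ 2 + d%:R ^+ n * l ^+ 2 by ring.
by rewrite lerD2r.
Qed.
End LocalLimit.

(** * Sums of inverse half-integer powers *)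

Section InvSqrt.
Variable R : rcfType.
Local Notation isq := (@inv_sqrt R).

Lemma inv_sqrt_gt0 n : (0 < n)%N -> 0 < isq n.
Proof. by move=> n0; rewrite invr_gt0 sqrtr_gt0 ltr0n. Qed.

Lemma inv_sqrt_le c m n : (0 < m)%N -> (0 < n)%N -> (m <= c ^ 2 * n)%N ->
  isq n <= c%:R * isq m.
Proof.
move=> m0 n0 mn.
rewrite -(@ler_pXn2r _ 2) ?nnegrE ?mulr_ge0 ?inv_sqrt_ge0 ?ler0n //.
rewrite exprMn !sqr_inv_sqrt ler_pdivlMr ?ltr0n // mulrC ler_pdivrMr ?ltr0n //.
by rewrite -natrX -natrM ler_nat.
Qed.

Lemma inv_sqrt_le1 n : isq n.+1 <= 1.
Proof.
rewrite -(@ler_pXn2r _ 2) ?nnegrE ?inv_sqrt_ge0 ?ler01 // sqr_inv_sqrt expr1n.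
by rewrite invf_le1 ?ltr0n // ler1n.
Qed.

Lemma inv_sqrt_sqr n : isq (n ^ 2) = n%:R^-1.
Proof. by rewrite /inv_sqrt natrX sqrtr_sqr normr_nat. Qed.

(** With [p] and [q] for consecutive inverse square roots, this relation reduces
    the two telescoping bounds to polynomial inequalities in [p] and [q]. *)
Lemma inv_sqrt_rec n : (0 < n)%N ->
  isq n ^+ 2 - isq n.+1 ^+ 2 = isq n ^+ 2 * isq n.+1 ^+ 2.
Proof.
move=> n0; have a0 : n%:R != 0 :> R by rewrite pnatr_eq0 -lt0n.
have b0 : n%:R + 1 != 0 :> R by rewrite natr1 pnatr_eq0.
by rewrite !sqr_inv_sqrt -[n.+1%:R]natr1; field; rewrite a0 b0.
Qed.

Lemma inv_sqrt_telescope3 n : (0 < n)%N ->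
  isq n.+1 ^+ 3 <= 2 * isq n - 2 * isq n.+1.
Proof.
move=> n0; have := inv_sqrt_rec n0; have := inv_sqrt_gt0 (ltn0Sn n).
have := inv_sqrt_gt0 n0; have : isq n.+1 <= isq n.
  by rewrite -[leRHS]mul1r -[1]/(1%:R); apply: inv_sqrt_le => //; lia.
move: (isq n) (isq n.+1) => p q qp p0 q0 e.
rewrite -(@ler_pM2r _ (p + q)) ?addr_gt0 //.
have -> : (2 * p - 2 * q) * (p + q) = 2 * (p ^+ 2 - q ^+ 2) by ring.
rewrite e; have -> : q ^+ 3 * (p + q) = q ^+ 2 * (q * (p + q)) by ring.
have -> : 2 * (p ^+ 2 * q ^+ 2) = q ^+ 2 * (2 * p ^+ 2) by ring.
by rewrite ler_wpM2l ?sqr_ge0 //; nra.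
Qed.

Lemma inv_sqrt_telescope5 n : (0 < n)%N ->
  isq n.+1 ^+ 5 <= 2 * isq n ^+ 3 - 2 * isq n.+1 ^+ 3.
Proof.
move=> n0; have := inv_sqrt_telescope3 n0; have := inv_sqrt_gt0 (ltn0Sn n).
have := inv_sqrt_gt0 n0; have : isq n.+1 <= isq n.
  by rewrite -[leRHS]mul1r -[1]/(1%:R); apply: inv_sqrt_le => //; lia.
move: (isq n) (isq n.+1) => p q qp p0 q0 le.
have -> : 2 * p ^+ 3 - 2 * q ^+ 3 = (2 * p - 2 * q) * (p ^+ 2 + p * q + q ^+ 2) by ring.
have -> : q ^+ 5 = q ^+ 3 * q ^+ 2 by ring.
apply: ler_pM => //; rewrite ?exprn_ge0 ?(ltW q0) //.
by rewrite lerDr addr_ge0 ?exprn_ge0 ?mulr_ge0 ?(ltW p0) ?(ltW q0).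
Qed.

Lemma sum_telescope_le (f g : nat -> R) a b :
  (forall j, (a <= j)%N -> f j <= g j - g j.+1) -> (forall j, 0 <= g j) ->
  \sum_(a <= j < b) f j <= g a.
Proof.
move=> fg g0; have [ab|ba] := leqP a b; last by rewrite big_geq // ltnW.
apply: le_trans (_ : \sum_(a <= j < b) (g j - g j.+1) <= _).
  rewrite big_nat_cond [leRHS]big_nat_cond; apply: ler_sum => j.
  by rewrite andbT => /andP[/fg].
have -> : \sum_(a <= j < b) (g j - g j.+1) = g a - g b.
  rewrite -opprB -telescope_sumr // -sumrN; apply: eq_bigr => j _.
  by rewrite opprB.
by rewrite gerBl.
Qed.

(** Each of the two summations costs one power of the decay in [j - i]. *)
Lemma sum_inv_sqrt5 t m M : (0 < m)%N ->
  \sum_(0 <= i < t.+1) \sum_(t + m <= j < M) isq (j - i + 2) ^+ 5 <= 4 * isq m.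
Proof.
move=> m0.
apply: le_trans (_ : \sum_(0 <= i < t.+1) 2 * isq (t - i + m + 1) ^+ 3 <= _).
  rewrite big_nat_cond [leRHS]big_nat_cond; apply: ler_sum => i /andP[it _].
  have -> : (t - i + m + 1 = (t + m) - i + 1)%N by lia.
  apply: (@sum_telescope_le _ (fun j => 2 * isq (j - i + 1) ^+ 3)) => [j tj|j].
    have -> : (j - i + 2 = (j - i + 1).+1)%N by lia.
    have -> : (j.+1 - i + 1 = (j - i + 1).+1)%N by lia.
    by apply: inv_sqrt_telescope5; lia.
  by rewrite mulr_ge0 ?exprn_ge0 ?inv_sqrt_ge0.
rewrite big_nat_rev /= add0n.
apply: le_trans (_ : \sum_(0 <= i < t.+1) 2 * isq (m + i).+1 ^+ 3 <= _).
  rewrite big_nat_cond [leRHS]big_nat_cond; apply: ler_sum => i /andP[it _].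
  by have -> : (t - (t.+1 - i.+1) + m + 1 = (m + i).+1)%N by lia.
rewrite -{2}[m]addn0.
apply: (@sum_telescope_le _ (fun i => 4 * isq (m + i))) => [j _|j].
  have := @inv_sqrt_telescope3 (m + j)%N; rewrite addnS.
  have mj : (0 < m + j)%N by lia.
  by move=> /(_ mj); lra.
by rewrite mulr_ge0 ?inv_sqrt_ge0.
Qed.

End InvSqrt.

(** * Walks that start with a long straight segment *)

Definition position d (w : seq ('I_d * bool)) (k : nat) : 'rV[int]_d :=
  displacement (take k w).

Section Hair.
Variables (R : rcfType) (d : nat) (r0 : 'I_d).
Hypothesis hd : (5 <= d)%N.
Local Notation D := ('I_d * bool)%type.
Local Notation isq := (@inv_sqrt R).

Definition hair_word L (s : seq D) : seq D := nseq L (r0, false) ++ s.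
Local Notation walk L s := (position (hair_word L s)).

Lemma displacement_cat (s t : seq D) :
  displacement (s ++ t) = displacement s + displacement t.
Proof. by rewrite /displacement big_cat. Qed.

Lemma hair_walkE L s k :
  walk L s k = delta_mx 0 r0 *+ minn k L + displacement (take (k - L) s).
Proof.
rewrite /position /hair_word take_cat size_nseq; case: ltnP => kL.
  rewrite (eqP (ltnW kL : k - L == 0)%N) take0 /displacement big_nil addr0.
  have -> : take k (nseq L (r0, false)) = nseq k (r0, false).
    by rewrite -(subnKC (ltnW kL)) nseqD take_size_cat ?size_nseq.
  rewrite big_nseq -Monoid.iteropE /=.
  by rewrite /step_vector /= expr0 scale1r; elim: k {kL} => //= k ->; rewrite mulrS.
rewrite displacement_cat; congr (_ + _).
rewrite /displacement big_nseq; elim: L {kL} => //= L ->.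
by rewrite /step_vector /= expr0 scale1r mulrS.
Qed.

Lemma displacement_coord_le (s : seq D) r : - (size s)%:Z <= displacement s 0 r.
Proof.
rewrite /displacement; elim: s => [|a s IHs]; first by rewrite big_nil mxE.
rewrite big_cons mxE /= -addn1 addnC PoszD opprD lerD //.
rewrite /step_vector !mxE eqxx /=; case: a => a [] /=; case: eqP => _; rewrite ?expr1 ?expr0; lia.
Qed.

Lemma hair_walk_sub L s i j : (i <= j)%N ->
  (walk L s i == walk L s j) =
  (displacement (drop (i - L) (take (j - L) s)) ==
     - (delta_mx 0 r0 *+ (minn j L - minn i L))).
Proof.
move=> ij; rewrite !hair_walkE.
have {1}-> : take (j - L) s = take (i - L) s ++ drop (i - L) (take (j - L) s).
  by rewrite -{1}(cat_take_drop (i - L) (take (j - L) s)) take_takel //; lia.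
rewrite displacement_cat -{1}[displacement (take (i - L) s)]addr0.
have {1}-> : minn j L = (minn i L + (minn j L - minn i L))%N by lia.
rewrite mulrnDr addrACA (addrC (_ *+ (_ - _))) -!addrA !(inj_eq (addrI _)).
by rewrite [LHS]eq_sym addr_eq0.
Qed.

(** The factor [32 = 2 ^ 5] pays for replacing [n + 1] by [j - i + 2] when the
    number [n] of free steps is at least half of [j - i]. *)
Definition collision_const : R := 32 * Num.sqrt d%:R ^+ d.

Lemma collision_const_ge0 : 0 <= collision_const.
Proof. by rewrite mulr_ge0 ?exprn_ge0 ?sqrtr_ge0 ?ler0n. Qed.

(** A straight stretch of the walk must be undone by at least as many free
    steps, so the number of free steps between the times [i] and [j] of a
    collision is at least half of [j - i], and the straight beginning costs
    only a constant factor, whatever its length [L]. *)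
Lemma collision_bound L N i j : (i < j)%N -> (j <= L + N)%N ->
  \sum_(s : N.-tuple D) (walk L s i == walk L s j)%:R <=
  (2 * d)%:R ^+ N * (collision_const * isq (j - i + 2) ^+ 5) :> R.
Proof.
move=> ij jN; under eq_bigr do rewrite hair_walk_sub 1?ltnW //.
set a := (minn j L - minn i L)%N; set n := (j - L - (i - L))%N.
have an : (a + n = j - i)%N by rewrite /a /n; lia.
have rhs0 : 0 <= (2 * d)%:R ^+ N * (collision_const * isq (j - i + 2) ^+ 5).
  by rewrite !mulr_ge0 ?exprn_ge0 ?ler0n ?collision_const_ge0 ?inv_sqrt_ge0.
have [na|an'] := ltnP n a.
  rewrite big1 // => s _; case: eqP => // e.
  have := displacement_coord_le (drop (i - L) (take (j - L) s)) r0.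
  rewrite e size_drop size_take_min size_tuple mxE mulmxnE mxE !eqxx /=.
  rewrite -[1 *+ a]/(a%:R) natz lerN2 lez_nat.
  have -> : (minn (j - L) N - (i - L) = n)%N by rewrite /n; lia.
  by rewrite leqNgt na.
rewrite (sum_tuple_infix (fun u => (displacement u == - (delta_mx 0 r0 *+ a))%:R));
  try by lia.
have d0 : (0 < d)%N by lia.
have cD : #|{: D}| = (2 * d)%N by rewrite card_prod card_ord card_bool mulnC.
rewrite cD -[leLHS]mulr_natr natrX.
apply: le_trans (ler_wpM2r _ (local_limit_bound R n _ d0)) _.
  by rewrite exprn_ge0 ?ler0n.
rewrite mulrAC -exprD subnKC; last by rewrite /n; lia.
rewrite ler_wpM2l ?exprn_ge0 ?ler0n // exprMn /collision_const (mulrC 32) -mulrA.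
rewrite ler_wpM2l ?exprn_ge0 ?sqrtr_ge0 //.
apply: (@le_trans _ _ (isq n.+1 ^+ 5)).
  by apply: ler_wiXn2l => //; rewrite ?inv_sqrt_ge0 ?inv_sqrt_le1.
have -> : 32 = 2 ^+ 5 :> R by rewrite -natrX.
rewrite -exprMn lerXn2r ?nnegrE ?mulr_ge0 ?inv_sqrt_ge0 ?ler0n //.
by apply: inv_sqrt_le => //; lia.
Qed.

Lemma exists_le_sum (I : finType) (P : pred I) :
  [exists i, P i]%:R <= \sum_i (P i)%:R :> R.
Proof.
case: existsP => [[i Pi]|_]; last by apply: sumr_ge0 => i _; exact: ler0n.
by rewrite (bigD1 i) //= Pi lerDl; apply: sumr_ge0 => j _; exact: ler0n.
Qed.

Lemma not_cut_bound L N t m : (0 < m)%N ->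
  \sum_(s : N.-tuple D) (~~ cut_at (walk L s) (L + N) t m)%:R <=
  (2 * d)%:R ^+ N * (4 * collision_const * isq m) :> R.
Proof.
move=> m0.
apply: le_trans (_ : \sum_(s : N.-tuple D) \sum_(0 <= i < t.+1)
    \sum_(t + m <= j < (L + N).+1) (walk L s i == walk L s j)%:R <= _).
  apply: ler_sum => s _; rewrite /cut_at negb_forall big_mkord.
  apply: le_trans (exists_le_sum _) _; apply: ler_sum => i _.
  rewrite negb_forall; apply: le_trans (exists_le_sum _) _.
  rewrite (big_nat_widenl (t + m) 0) // big_mkord [leRHS]big_mkcond /=.
  apply: ler_sum => j _; rewrite negb_imply negbK.
  by case: leqP.
rewrite exchange_big /=.
apply: le_trans (_ : (2 * d)%:R ^+ N * (collision_const * 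
   \sum_(0 <= i < t.+1) \sum_(t + m <= j < (L + N).+1) isq (j - i + 2) ^+ 5) <= _).
  rewrite !mulr_sumr big_nat_cond [leRHS]big_nat_cond.
  apply: ler_sum => i /andP[it _]; rewrite exchange_big /= !mulr_sumr.
  rewrite big_nat_cond [leRHS]big_nat_cond; apply: ler_sum => j /andP[/andP[tj jN] _].
  by apply: collision_bound; lia.
rewrite ler_wpM2l ?exprn_ge0 ?ler0n // [leRHS]mulrAC [leRHS]mulrC.
rewrite ler_wpM2l ?collision_const_ge0 //; exact: sum_inv_sqrt5.
Qed.

Definition cut_const : R := 4 * collision_const.

Lemma cut_const_ge0 : 0 <= cut_const.
Proof. by rewrite mulr_ge0 ?ler0n ?collision_const_ge0. Qed.

Let hgt0 k : 0 < (2 ^ k)%:R :> R.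
Proof. by rewrite ltr0n expn_gt0. Qed.

Lemma not_cut_sqr_bound L N t h : (0 < h)%N ->
  \sum_(s : N.-tuple D) (~~ cut_at (walk L s) (L + N) t (h ^ 2))%:R <=
  (2 * d)%:R ^+ N * (cut_const / h%:R) :> R.
Proof. by move=> h0; rewrite -inv_sqrt_sqr; apply: not_cut_bound; rewrite expn_gt0 h0. Qed.

Lemma not_window_cuts_bound L N k :
  \sum_(s : N.-tuple D) (~~ window_cuts (walk L s) (L + N) k)%:R <=
  (2 * d)%:R ^+ N * ((2 ^ 14).+1%:R * cut_const / (2 ^ k)%:R) :> R.
Proof.
set h := (2 ^ k)%N; have h0 : 0 < h%:R :> R := hgt0 k.
apply: le_trans (_ : \sum_(s : N.-tuple D) \sum_(i < (2 ^ 14 * h ^ 4).+1)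
   (~~ cut_at (walk L s) (L + N) (i * h ^ 10) ((h ^ 5) ^ 2))%:R <= _).
  apply: ler_sum => s _; rewrite -expnM /window_cuts negb_forall.
  exact: exists_le_sum.
rewrite exchange_big /=.
apply: le_trans (ler_sum _ (fun i _ => not_cut_sqr_bound _ _ _ _)) _.
  by rewrite !expn_gt0.
rewrite sumr_const card_ord -[leLHS]mulr_natr -[leLHS]mulrA ler_wpM2l ?exprn_ge0 ?ler0n //.
move: cut_const cut_const_ge0 => c c0.
rewrite [_.+1%:R * c]mulrC -!mulrA ler_wpM2l //.
rewrite [leLHS]mulrC ler_pdivrMr ?ltr0n ?expn_gt0 //.
have -> : (2 ^ 14).+1%:R / h%:R * (h ^ 5)%:R = (2 ^ 14).+1%:R * (h ^ 4)%:R :> R.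
  by rewrite (expnS h 4) natrM -mulrA (mulrA _^-1) mulVf ?gt_eqF // mul1r.
by rewrite -natrM ler_nat mulSn addnC -addn1 leq_add2l !expn_gt0.
Qed.

(** Markov's inequality for the number of grid times without a cut. *)
Lemma not_many_cuts_bound L N k :
  \sum_(s : N.-tuple D) (~~ many_cuts (walk L s) (L + N) k)%:R <=
  (2 * d)%:R ^+ N * (2 * cut_const / (2 ^ k)%:R) :> R.
Proof.
rewrite /many_cuts; set h := (2 ^ k)%N; have h0 : 0 < h%:R :> R := hgt0 k.
have n0 : 0 < (h ^ 12)%:R :> R by rewrite ltr0n !expn_gt0.
rewrite -(ler_pM2l n0).
apply: le_trans (_ : \sum_(s : N.-tuple D) 2 * \sum_(i < h ^ 12)
   (~~ cut_at (walk L s) (L + N) (i * h ^ 2) (h ^ 2))%:R <= _).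
  rewrite mulr_sumr; apply: ler_sum => s _.
  set A := [set i : 'I_(h ^ 12) | _].
  have -> : \sum_(i < h ^ 12) (~~ cut_at (walk L s) (L + N) (i * h ^ 2) (h ^ 2))%:R
      = #|~: A|%:R :> R.
    rewrite -sum1_card natr_sum [RHS]big_mkcond /=; apply: eq_bigr => i _.
    by rewrite !inE; case: cut_at.
  case: leqP => hA /=; first by rewrite mulr0 -natrM ler0n.
  rewrite mulr1 -natrM ler_nat; have := cardsC A; rewrite card_ord => e.
  by move: (h ^ 12)%N #|A| #|~: A| hA e => n a b; lia.
rewrite -mulr_sumr exchange_big /=.
apply: le_trans (ler_wpM2l _ (ler_sum _ (fun i _ => not_cut_sqr_bound _ _ _ _))) _.
- by [].
- by rewrite expn_gt0.
rewrite sumr_const card_ord -[_ *+ (h ^ 12)]mulr_natl.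
rewrite le_eqVlt; apply/orP; left; apply/eqP.
by move: cut_const => c; field; rewrite gt_eqF.
Qed.

Lemma straight_injective L (s : seq D) i j : (i < j)%N -> (j <= L)%N ->
  walk L s i <> walk L s j.
Proof.
move=> ij jL; rewrite !hair_walkE.
rewrite (eqP (jL : j - L == 0)%N) (eqP (ltnW (leq_trans ij jL) : i - L == 0)%N).
rewrite (minn_idPl jL) (minn_idPl (ltnW (leq_trans ij jL))) => /addIr.
move=> /(congr1 (fun x : 'rV[int]_d => x 0 r0)); rewrite !mulmxnE !mxE !eqxx /=.
rewrite -[1 *+ i]/(i%:R) -[1 *+ j]/(j%:R) !natz => -[e].
by rewrite e ltnn in ij.
Qed.

(** The first half of the straight segment consists of cuts of width one as
    soon as the walk never comes back to it after the second half. *)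
Lemma not_hair_bound N k S0 : S0 = ((2 ^ k) ^ 14)%N ->
  \sum_(s : N.-tuple D) (~~ [forall t : 'I_S0,
     cut_at (walk (2 * S0) s) (2 * S0 + N) t 1])%:R <=
  (2 * d)%:R ^+ N * (cut_const / (2 ^ k)%:R) :> R.
Proof.
set h := (2 ^ k)%N; have h0 : 0 < h%:R :> R := hgt0 k.
have -> : (h ^ 14 = (h ^ 7) ^ 2)%N by rewrite -expnM.
move=> eS.
apply: le_trans (_ : \sum_(s : N.-tuple D)
  (~~ cut_at (walk (2 * S0) s) (2 * S0 + N) S0 ((h ^ 7) ^ 2))%:R <= _).
  apply: ler_sum => s _; rewrite ler_nat.
  have [/cut_atP cut|_] := boolP (cut_at _ _ S0 _); last exact: leq_b1.
  rewrite leqn0 eqb0 negbK; apply/forallP => t; apply/cut_atP => i j it tj jN.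
  have [jL|Lj] := leqP j (2 * S0); first by apply: straight_injective => //; lia.
  by apply: cut => //; rewrite -?eS; have := ltn_ord t; lia.
apply: le_trans (not_cut_sqr_bound _ _ _ _) _; first by rewrite !expn_gt0.
rewrite ler_wpM2l ?exprn_ge0 ?ler0n //.
move: cut_const cut_const_ge0 => c c0; rewrite ler_wpM2l //.
rewrite lef_pV2 ?posrE ?ltr0n ?expn_gt0 // ler_nat -{1}[h]expn1.
by rewrite leq_pexp2l // expn_gt0.
Qed.

(** Union bound over the straight segment and over all scales from [2 ^ k0] on;
    the latter is a geometric series. *)
Lemma not_good_bound N k0 S0 : S0 = ((2 ^ k0) ^ 14)%N ->
  \sum_(s : N.-tuple D)
     (~~ good_trajectory (walk (2 * S0) s) (2 * S0 + N) k0)%:R <=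
  (2 * d)%:R ^+ N * ((2 * (2 ^ 14).+4)%:R * cut_const / (2 ^ k0)%:R) :> R.
Proof.
move=> eS; set M := (2 * S0 + N)%N.
pose wc k (s : N.-tuple D) := window_cuts (walk (2 * S0) s) M k.
pose mc k (s : N.-tuple D) := many_cuts (walk (2 * S0) s) M k.
apply: le_trans (_ : \sum_(s : N.-tuple D)
   ((~~ [forall t : 'I_S0, cut_at (walk (2 * S0) s) M t 1])%:R +
    \sum_(k0 <= k < M.+1) ((~~ wc k s)%:R + (~~ mc k s)%:R)) <= _).
  apply: ler_sum => s _; rewrite /good_trajectory -eS negb_and.
  apply: (@le_trans _ _ ((~~ [forall t : 'I_S0, cut_at (walk (2 * S0) s) M t 1])%:R +
    (~~ [forall k : 'I_M.+1, (k0 <= k)%N ==> wc k s && mc k s])%:R)).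
    by case: (~~ _); case: (~~ _); rewrite /= ?addr0 ?add0r ?lerDl ?ler0n ?ler01.
  rewrite lerD2l negb_forall; apply: le_trans (exists_le_sum _) _.
  rewrite (big_nat_widenl k0 0) // big_mkord [leRHS]big_mkcond /=.
  apply: ler_sum => k _; rewrite negb_imply negb_and.
  case: leqP => //= _; case: (wc _ _) => /=; rewrite ?addr0 ?add0r ?lerDl ?ler0n //.
rewrite big_split /= exchange_big /=.
apply: le_trans (_ : (2 * d)%:R ^+ N * (cut_const / (2 ^ k0)%:R) +
  \sum_(k0 <= k < M.+1) (2 * d)%:R ^+ N * ((2 ^ 14).+3%:R * cut_const / (2 ^ k)%:R) <= _).
  apply: lerD; first exact: not_hair_bound.
  apply: ler_sum => k _; rewrite big_split /=.
  apply: le_trans (lerD (not_window_cuts_bound _ _ _) (not_many_cuts_bound _ _ _)) _.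
  rewrite -mulrDr -!mulrDl ler_wpM2l ?exprn_ge0 ?ler0n //.
  by rewrite -natrD addn2.
rewrite -mulr_sumr -mulrDr ler_wpM2l ?exprn_ge0 ?ler0n //.
move: cut_const cut_const_ge0 (2 ^ 14)%N => c c0 q; set K := q.+3.
have sumK : \sum_(k0 <= k < M.+1) (K%:R * c / (2 ^ k)%:R) <=
    2 * (K%:R * c / (2 ^ k0)%:R).
  apply: (@sum_telescope_le _ _ (fun k => 2 * (K%:R * c / (2 ^ k)%:R))) => k.
    have -> : 2 * (K%:R * c / (2 ^ k.+1)%:R) = K%:R * c / (2 ^ k)%:R.
      by rewrite expnS natrM; field; rewrite gt_eqF.
    by move: (K%:R * c / (2 ^ k)%:R) => x; lra.
  by rewrite !mulr_ge0 ?invr_ge0 ?ler0n.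
apply: le_trans (lerD (lexx _) sumK) _.
have -> : 2 * (K%:R * c / (2 ^ k0)%:R) = (2 * K)%:R * c / (2 ^ k0)%:R.
  by rewrite natrM !mulrA.
rewrite -mulrDl ler_wpM2r ?invr_ge0 ?ler0n // -{1}[c]mul1r -mulrDl ler_wpM2r //.
by rewrite addrC natr1 ler_nat /K !mulnS; lia.
Qed.
End Hair.

(** * From words of steps to the random walk *)

Import HBNNSimple.

(** The integral of a nonnegative function is a supremum over simple functions
    below it, so the function itself may fail to be measurable. *)
Lemma integral_ge_on (R : realType) (disp : measure_display)
    (T : measurableType disp) (mu : {measure set T -> \bar R})
    (f : T -> \bar R) (A : set T) (c : R) :
  measurable A -> 0 <= c -> (forall x, 0 <= f x)%E -> (forall x, A x -> c%:E <= f x)%E ->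
  (c%:E * mu A <= \int[mu]_x f x)%E.
Proof.
move=> mA c0 f0 fA; rewrite ge0_integralTE //.
apply: ereal_sup_ubound; exists (scale_nnsfun (indic_nnsfun R mA) c0) => /=.
  move=> x; rewrite -[X in (c * X)%:E]/(\1_A x) indicE; have [xA|_] := boolP (x \in A).
    by rewrite mulr1; apply: fA; rewrite inE in xA.
  by rewrite mulr0.
by have := sintegralrM mu c (indic_nnsfun R mA); rewrite sintegral_indic.
Qed.

Lemma limn_einf_ge (R : realType) (u : nat -> \bar R) (c : \bar R) n0 :
  (forall n, (n0 <= n)%N -> c <= u n)%E -> (c <= limn_einf u)%E.
Proof.
move=> cu; rewrite limn_einf_lim; apply: lime_ge; first exact: is_cvg_einfs.
near=> m; apply: le_ereal_inf_tmp => _ [p /= mp] <-; apply: cu.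
by apply: leq_trans mp; near: m; exact: nbhs_infty_ge.
Unshelve. all: by end_near. Qed.

Section WordLaw.
Variable d : nat.
Local Notation D := ('I_d * bool)%type.

Lemma position_step (w : seq D) i a0 : (i < size w)%N ->
  position w i.+1 = position w i + step_vector (nth a0 w i).
Proof.
move=> iw; rewrite /position (take_nth a0 iw) -cats1 displacement_cat.
by congr (_ + _); rewrite /displacement big_seq1.
Qed.

Lemma step_vector_coord (a : D) r :
  step_vector a 0 r = if r == a.1 then (-1) ^+ a.2 else 0.
Proof. by rewrite /step_vector !mxE eqxx /=; case: eqP => _; rewrite ?mulr1 ?mulr0. Qed.

Lemma step_vector_inj : injective (@step_vector d).
Proof.
move=> [r b] [r' b'] /(congr1 (fun x : 'rV[int]_d => x 0 r)).
rewrite !step_vector_coord eqxx /=; case: eqP => [<-|_]; case: b; case: b'.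
all: by rewrite ?expr1 ?expr0.
Qed.

Lemma position_inj (w w' : seq D) : size w = size w' ->
  (forall i, (i <= size w)%N -> position w i = position w' i) -> w = w'.
Proof.
move=> sz eqp; case: w sz eqp => [|a0 w1]; first by case: w'.
set w := a0 :: w1 => sz eqp.
apply: (eq_from_nth (x0 := a0) sz) => i iw; apply: step_vector_inj.
have iw' : (i < size w')%N by rewrite -sz.
apply: (addrI (position w i)); rewrite -position_step // eqp //.
by rewrite (position_step a0 iw') eqp // ltnW.
Qed.

Lemma lattice_adj_position (v : lattice d) (w : seq D) i : (i < size w)%N ->
  lattice_adj (v + position w i) (v + position w i.+1).
Proof.
move=> iw; have [a0 _] : {a0 : D | true} by case: w iw => // a0 _ _; exists a0.
rewrite /lattice_adj (position_step a0 iw); set a := nth a0 w i.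
have coord r : `|(v + position w i) ord0 r -
    (v + (position w i + step_vector a)) ord0 r| = (r == a.1)%:R :> int.
  rewrite addrA -[ord0]/(0 : 'I_1) [X in `|_ - X|]mxE opprD addNKr normrN.
  rewrite step_vector_coord; case: eqP => _; last by rewrite normr0.
  by rewrite normrX normrN1 expr1n.
rewrite (eq_bigr _ (fun r _ => coord r)) (bigD1 a.1) //= eqxx big1 ?addr0 //.
by move=> r /negPf ->.
Qed.

End WordLaw.

Lemma Psi_prob_ge0 (K : choiceType) (G : fsgraph K) (R : realType) (u : K) :
  0 <= Psi_prob G R u.
Proof.
by apply: sumr_ge0 => p _; rewrite mulr_ge0 ?addr_ge0 ?divr_ge0 ?invr_ge0 ?ler0n.
Qed.

Section WalkLaw.
Variables (R : realType) (disp : measure_display) (T : measurableType disp).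
Variables (P : probability T R) (d : nat) (v : lattice d) (X : nat -> T -> lattice d).
Hypothesis hX : is_simple_random_walk P v X.
Local Notation D := ('I_d * bool)%type.

Definition follows (w : seq D) : set T :=
  [set o | forall i, (i <= size w)%N -> X i o = v + position w i]%classic.

Lemma measurable_follows w : measurable (follows w).
Proof.
have -> : follows w = (\bigcap_i (if (i <= size w)%N
    then [set o | X i o = v + position w i] else setT))%classic.
  apply/seteqP; split=> o /= h i; first by move=> _; case: ifP => // /h.
  by move=> iw; have := h i I; rewrite iw.
apply: bigcapT_measurable => i; case: ifP => _; last exact: measurableT.
exact: hX.1.
Qed.

Lemma prob_follows w : P (follows w) = ((2 * d)%:R^-1 ^+ size w)%:E.
Proof.
rewrite /follows (hX.2 (size w) (fun i => v + position w i)); congr _%:E.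
rewrite {1}/position take0 /displacement big_nil addr0 eqxx mul1r.
rewrite -[in RHS](card_ord (size w)) -prodr_const; apply: eq_bigr => i _.
by rewrite /srw_step lattice_adj_position.
Qed.

Lemma follows_disjoint w w' o : size w = size w' -> follows w o -> follows w' o ->
  w = w'.
Proof.
move=> sz fw fw'; apply: position_inj => // i iw.
by apply: (addrI v); rewrite -fw // fw' // -sz.
Qed.

(** Walks that follow distinct words of the same length are disjoint events. *)
Lemma prob_follows_some n N (f : n.-tuple D -> seq D) (Q : pred (n.-tuple D)) :
  injective f -> (forall s, size (f s) = N) ->
  let A := (\bigcup_(s in [set s | Q s]) follows (f s))%classic in
  measurable A /\ P A = (#|Q|%:R * (2 * d)%:R^-1 ^+ N)%:E.
Proof.
move=> fI sf A; have fin : finite_set [set s | Q s]%classic by exact: finite_finset.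
split; first by apply: fin_bigcup_measurable => // s _; exact: measurable_follows.
rewrite measure_fin_bigcup; last 3 first.
- exact: fin.
- move=> s t _ _ [w [fs ft]]; apply: fI.
  by apply: follows_disjoint fs ft; rewrite !sf.
- by move=> s _; exact: measurable_follows.
rewrite -(@bigfs _ _ _ _ (index_enum (n.-tuple D)) Q); last 2 first.
- exact: index_enum_uniq.
- by move=> s _; rewrite mem_index_enum.
transitivity (\sum_(s | Q s) (((2 * d)%:R^-1 ^+ N)%R : R)%:E)%E.
  by apply: eq_bigr => s _; have := prob_follows (f s); rewrite sf.
by rewrite sumEFin sumr_const mulr_natl.
Qed.

End WalkLaw.

Lemma exists_scale (R : realType) (K : R) : exists2 k, (2 <= k)%N & K <= (2 ^ k)%:R.
Proof.
exists (maxn 2 (Num.bound `|K|)); first exact: leq_maxl.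
apply: le_trans (ler_norm K) _; apply: le_trans (ltW (archi_boundP (normr_ge0 K))) _.
rewrite ler_nat; apply: leq_trans (leq_maxr 2 _) _.
exact: ltnW (ltn_expl _ (ltnSn 1)).
Qed.

Theorem theorem1p6 (d : nat) (hd : (5 <= d)%N) (v : lattice d)
    (R : realType) (disp : measure_display) (T : measurableType disp)
    (P : probability T R) (X : nat -> T -> lattice d)
    (hX : is_simple_random_walk P v X) :
  (0 < limn_einf (fun n : nat => Psi_range_prob P X n v))%E.
Proof.
have d0 : (0 < d)%N by lia.
pose r0 := Ordinal d0.
have dR : 0 < (2 * d)%:R :> R by rewrite ltr0n muln_gt0.
have [k0 k02 hk0] := exists_scale (2 * ((2 * (2 ^ 14).+4)%:R * cut_const R d)).
pose S0 := ((2 ^ k0) ^ 14)%N.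
(* One half for the coin of [Psi], one half for the good words among those with
   a straight beginning, and the probability of that beginning. *)
pose c : R := 1 / 2 * (1 / 2 * (2 * d)%:R^-1 ^+ (2 * S0)).
have c0 : 0 < c by rewrite /c !mulr_gt0 ?exprn_gt0 ?invr_gt0.
apply: (@lt_le_trans _ _ c%:E); first by rewrite lte_fin.
apply: (@limn_einf_ge _ _ _ 1) => n n0.
(* The horizon depends on [n]; the bound [c] does not. *)
pose k := maxn k0 n; pose N := ((2 ^ k) ^ 14)%N; pose M := (2 * S0 + N)%N.
pose D := ('I_d * bool)%type.
pose Q := [pred s : N.-tuple D | good_trajectory (position (hair_word r0 (2 * S0) s)) M k0].
have sizeW (s : N.-tuple D) : size (hair_word r0 (2 * S0) s) = M.
  by rewrite size_cat size_nseq size_tuple.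
have injW : injective (fun s : N.-tuple D => hair_word r0 (2 * S0) s).
  move=> s t /eqP; rewrite eqseq_cat // eqxx => /eqP e; exact: val_inj.
have [mA PA] := prob_follows_some hX Q injW sizeW.
set A := (\bigcup_(s in _) _)%classic in mA PA.
have cardQ : 1 / 2 * (2 * d)%:R ^+ N <= #|Q|%:R :> R.
  have := @not_good_bound R d r0 hd N k0 S0 erefl.
  have -> : \sum_(s : N.-tuple D) (~~ good_trajectory
      (position (hair_word r0 (2 * S0) s)) (2 * S0 + N) k0)%:R =
      (2 * d)%:R ^+ N - #|Q|%:R :> R.
    have cD : #|{: N.-tuple D}| = ((2 * d) ^ N)%N.
      by rewrite card_tuple card_prod card_ord card_bool mulnC.
    rewrite -natrX -cD -(cardC Q) natrD addrAC subrr add0r.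
    rewrite -sum1_card natr_sum [RHS]big_mkcond /=; apply: eq_bigr => s _.
    by rewrite !inE; case: good_trajectory.
  move: (_ * cut_const R d) hk0 => C hk0.
  have half : C / (2 ^ k0)%:R <= 1 / 2.
    by rewrite ler_pdivrMr ?ltr0n ?expn_gt0 //; move: ((2 ^ k0)%:R) hk0 => h; lra.
  have W0 : 0 <= (2 * d)%:R ^+ N :> R by rewrite exprn_ge0 // ltW.
  by move=> /le_trans/(_ (ler_wpM2l W0 half)); lra.
have PAc : (((1 / 2 * (2 * d)%:R^-1 ^+ (2 * S0)))%:E <= P A)%E.
  rewrite PA lee_fin; apply: le_trans (ler_wpM2r _ cardQ).
    by rewrite /M exprD mulrACA -exprMn mulfV ?gt_eqF // expr1n mulr1.
  by rewrite exprn_ge0 // invr_ge0 ltW.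
rewrite /c EFinM; apply: le_trans (lee_wpmul2l _ PAc) _; first by rewrite lee_fin divr_ge0.
apply: integral_ge_on => //.
- by move=> o; case: (range_graph _ n) => [G|] //; rewrite lee_fin Psi_prob_ge0.
move=> w [s /= sQ so].
have Xs i : (i <= M)%N -> X i w = v + position (hair_word r0 (2 * S0) s) i.
  by move=> iM; apply: so; rewrite sizeW.
have good : good_trajectory (fun i => X i w) M k0.
  rewrite (eq_good_trajectory (y := position (hair_word r0 (2 * S0) s))) //.
  by move=> i j iM jM; rewrite !Xs // (inj_eq (addrI v)).
have kM : (k0 <= k <= M)%N.
  rewrite leq_maxl /= /M /N; apply: (leq_trans (ltnW (ltn_expl k (ltnSn 1)))).
  apply: leq_trans (leq_addl _ _); rewrite -{1}[(2 ^ k)%N]expn1.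
  by rewrite leq_pexp2l // expn_gt0.
have nk : (2 * n <= (2 ^ k) ^ 12)%N.
  have n2 : (n <= 2 ^ k)%N.
    by apply: leq_trans (leq_maxr k0 n) _; exact: ltnW (ltn_expl k (ltnSn 1)).
  apply: leq_trans (leq_mul (leqnn 2) n2) _; rewrite -expnS -expnM leq_exp2l //.
  by have := leq_maxl k0 n; rewrite -/k; lia.
have [t tM ->] := good_range_graph k02 good n0 kM (leq_addl _ _) nk.
rewrite lee_fin; have := good_Psi_prob k02 good R tM.
by rewrite /= Xs // {1}/position take0 /displacement big_nil addr0.
Qed.
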